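(* Let $n_1,\dots,n_m$ be positive integers, $n=\prod_{j=1}^m n_j$, and $\Omega=\times_{j=1}^m\overline{\mathbb{C}}^{n_j}$ where $\overline{\mathbb{C}}^{k}=\{x\in\mathbb{C}^k: x^\dagger x=1\}$. Let $\tilde\rho$ be an $n\times n$ density matrix (Hermitian, positive semidefinite, trace one) and let $$\mathscr{C}=\{g(x_1,\dots,x_m)=(\otimes_{j=1}^m x_j)^\dagger G(\otimes_{j=1}^m x_j)\ :\ G \text{ an } n\times n \text{ Hermitian matrix},\ \operatorname{Tr}(G\tilde\rho)\ge 0\}.$$ Let $\mathcal{L}^{\geq}$ denote the set of all bounded real-valued functions $h$ on $\Omega$ with $\inf h\ge 0$. Then the following are equivalent: (1) $\tilde\rho$ is entangled; (2) $\operatorname{posi}(\mathscr{C}\cup\mathcal{L}^{\geq})$ is not coherent, i.e. it contains a function $f$ on $\Omega$ with $\sup f<0$.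
   Context: $\operatorname{posi}$ denotes the conic hull (all finite nonnegative linear combinations). A density matrix on $\mathbb{C}^{n}=\otimes_j\mathbb{C}^{n_j}$ is separable if it is a convex combination of product density matrices $\rho_1\otimes\cdots\otimes\rho_m$ with $\rho_j$ a density matrix on $\mathbb{C}^{n_j}$, and entangled otherwise. *)

(* Defs.v *)
From HB Require Import structures.
From mathcomp Require Import all_boot all_order all_algebra.
From mathcomp Require Import all_classical all_reals.
From mathcomp Require Import complex.
Set Implicit Arguments. Unset Strict Implicit. Unset Printing Implicit Defensive.
Import Order.TTheory GRing.Theory Num.Theory.
Local Open Scope ring_scope.
Local Open Scope classical_set_scope.
Local Open Scope complex_scope.

Section QDefs.
Variable R : realType.
Notation C := R[i].

Definition cmat (I : finType) := I -> I -> C.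
Definition cvec (I : finType) := I -> C.

Definition mtrace (I : finType) (A : cmat I) : C := \sum_(i : I) A i i.
Definition mmul (I : finType) (A B : cmat I) : cmat I :=
  fun i k => \sum_(l : I) A i l * B l k.
Definition qform (I : finType) (A : cmat I) (v : cvec I) : C :=
  \sum_(i : I) \sum_(k : I) (v i)^* * A i k * v k.

Definition hermitian (I : finType) (A : cmat I) : Prop :=
  forall i k, A i k = (A k i)^*.
Definition psd (I : finType) (A : cmat I) : Prop :=
  forall v : cvec I, 0 <= qform A v.
Definition density (I : finType) (A : cmat I) : Prop :=
  [/\ hermitian A, psd A & mtrace A = 1].

(* The composite system C^{n_1} (x) ... (x) C^{n_m}, n = prod_j n_j, indexed by
   multi-indices (i_1,...,i_m). *)
Definition tidx (m : nat) (dims : 'I_m -> nat) : finType :=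
  {dffun forall j : 'I_m, 'I_(dims j)}.

Definition tensor_mat (m : nat) (dims : 'I_m -> nat)
  (r : forall j : 'I_m, cmat 'I_(dims j)) : cmat (tidx dims) :=
  fun a b => \prod_(j : 'I_m) r j (a j) (b j).

Definition tensor_vec (m : nat) (dims : 'I_m -> nat)
  (x : forall j : 'I_m, cvec 'I_(dims j)) : cvec (tidx dims) :=
  fun a => \prod_(j : 'I_m) x j (a j).

Definition separable (m : nat) (dims : 'I_m -> nat) (rho : cmat (tidx dims)) : Prop :=
  exists (K : nat) (p : 'I_K -> R) (r : 'I_K -> forall j : 'I_m, cmat 'I_(dims j)),
    [/\ forall l, 0 <= p l, \sum_(l < K) p l = 1,
        forall l j, density (r l j) &
        rho = fun a b => \sum_(l < K) (p l)%:C * tensor_mat (r l) a b].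

Definition entangled (m : nat) (dims : 'I_m -> nat) (rho : cmat (tidx dims)) : Prop :=
  density rho /\ ~ separable rho.

Definition unit_vec (k : nat) (x : cvec 'I_k) : Prop :=
  \sum_(i < k) (x i)^* * x i = 1.

Definition Omega (m : nat) (dims : 'I_m -> nat) : Type :=
  {x : forall j : 'I_m, cvec 'I_(dims j) | forall j, unit_vec (x j)}.

Definition posi (T : Type) (S : set (T -> R)) : set (T -> R) :=
  [set f | exists (K : nat) (lam : 'I_K -> R) (s : 'I_K -> T -> R),
     [/\ forall i, 0 <= lam i, forall i, S (s i) &
         f = fun t => \sum_(i < K) lam i * s i t]].

(* the set script-C: g(x) = (x_1 (x) ... (x) x_m)^dagger G (x_1 (x) ... (x) x_m),
   G Hermitian with Tr(G rho~) >= 0; the value is real since G is Hermitian,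
   and we take it as an element of R via its real part. *)
Definition scriptC (m : nat) (dims : 'I_m -> nat) (rho : cmat (tidx dims))
  : set (Omega dims -> R) :=
  [set g | exists G : cmat (tidx dims),
     [/\ hermitian G, 0 <= mtrace (mmul G rho) &
         g = fun x => complex.Re (qform G (tensor_vec (sval x)))]].

Definition Lge (T : Type) : set (T -> R) :=
  [set h | (exists M : R, forall t, `|h t| <= M) /\ 0 <= inf (range h)].

Definition not_coherent (T : Type) (S : set (T -> R)) : Prop :=
  exists f, S f /\ sup (range f) < 0.

End QDefs.

(* Main.v *)
(* Expectations of Hermitian G in product states x are Tr (G x x^dagger), so
   everything is about the convex hull of the pure product states x x^dagger.
   By the spectral theorem applied to each tensor factor, this hull is exactly
   the set of separable states.

   If rho is separable, averaging f in posi(C u L^>=) over the pure product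
   states that decompose rho gives a nonnegative number, so sup f < 0 is
   impossible.  If rho is not separable, it lies outside the hull of a compact
   set; by Caratheodory's theorem a bounded number of points suffices, so the
   distance from rho to the hull is attained, and the closest point gives a
   hyperplane separating strictly.  It is represented by a Hermitian G with
   Tr (G rho) = 0 and x^dagger G x <= -e for every pure product state x. *)

Require Import Defs.
From HB Require Import structures.
From mathcomp Require Import all_boot all_order all_algebra.
From mathcomp Require Import all_classical all_reals.
From mathcomp Require Import complex spectral.
From mathcomp Require Import topology normedtype derive.
From mathcomp Require Import ring lra.
Set Implicit Arguments. Unset Strict Implicit. Unset Printing Implicit Defensive.
Import Order.TTheory GRing.Theory Num.Theory.
Import numFieldNormedType.Exports.
Local Open Scope ring_scope.
Local Open Scope classical_set_scope.
Local Open Scope complex_scope.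

(** * Continuity of real-valued functions *)

Lemma continuous_sum (R : realType) (T : topologicalType) (I : finType)
    (F : I -> T -> R) :
  (forall i, continuous (F i)) -> continuous (fun x => \sum_i F i x).
Proof.
by move=> cF; apply: continuous_big => //; exact: add_continuous.
Qed.

Lemma continuous_add (R : realType) (T : topologicalType) (f g : T -> R) :
  continuous f -> continuous g -> continuous (fun x => f x + g x).
Proof. by move=> cf cg x; apply: cvgD; [exact: cf|exact: cg]. Qed.

Lemma continuous_mul (R : realType) (T : topologicalType) (f g : T -> R) :
  continuous f -> continuous g -> continuous (fun x => f x * g x).
Proof. by move=> cf cg x; apply: cvgM; [exact: cf|exact: cg]. Qed.

Lemma continuous_subr (R : realType) (T : topologicalType) (f : T -> R) (c : R) :
  continuous f -> continuous (fun x => f x - c).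
Proof. by move=> cf x; apply: cvgB; [exact: cf|exact: cvg_cst]. Qed.

Lemma closed_level (R : realType) (T : topologicalType) (f : T -> R) (c : R) :
  continuous f -> closed [set x | f x = c].
Proof.
by move=> cf; apply: (@preimage_closed _ _ f [set y | y = c]) => [x _|];
  [exact: cf|exact: closed_eq].
Qed.

Lemma continuous_compose (T U V : topologicalType) (f : T -> U) (g : U -> V) :
  continuous f -> continuous g -> continuous (fun x => g (f x)).
Proof. by move=> cf cg x; apply: continuous_comp; [exact: cf|exact: cg]. Qed.

(* Convex combinations of exactly N points of k @` A; the points stay
   parametrised by A, so that compactness is only needed of A. *)
Definition hull (R : realType) (T D : Type) (k : T -> D -> R) (A : set T)
    (N : nat) : set (D -> R) :=
  [set z | exists (w : 'I_N -> R) (a : 'I_N -> T),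
    [/\ forall i, 0 <= w i, \sum_i w i = 1, forall i, A (a i) &
        forall d, z d = \sum_i w i * k (a i) d]].

(** * Caratheodory's theorem for finite-dimensional convex hulls *)

Section Hull.
Context (R : realType) (T : Type) (D : finType) (k : T -> D -> R) (A : set T).

Lemma hull_widen N M z : (N <= M)%N -> hull k A N z -> hull k A M z.
Proof.
move=> /subnK <-; elim: (M - N)%N => // {M} m IH /IH [w [a [w0 w1 Aa za]]].
rewrite addSn; case: (m + N)%N w a w0 w1 Aa za => [|n] w a w0 w1 Aa za.
  by move: w1; rewrite big_ord0 => /eqP; rewrite eq_sym oner_eq0.
(* The added point has weight zero; repeating [a ord0] keeps it in [A]. *)
exists (fun i => oapp w 0 (unlift ord0 i)), (fun i => oapp a (a ord0) (unlift ord0 i)).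
split=> [i||i|d].
- by case: (unlift _ _) => [j|] /=.
- rewrite big_ord_recl unlift_none /= add0r -w1.
  by apply: eq_bigr => i _; rewrite liftK.
- by case: (unlift _ _) => [j|] /=.
- rewrite big_ord_recl unlift_none /= mul0r add0r za.
  by apply: eq_bigr => i _; rewrite liftK.
Qed.

(** The vectors [(1, k (a i))] live in dimension [#|D| + 1], so more of them than that are linearly
    dependent; the leading 1 makes the coefficients sum to zero. *)
Lemma affine_dependence (N : nat) (a : 'I_N -> T) : (#|D|.+1 < N)%N ->
  exists c : 'I_N -> R, [/\ exists i, 0 < c i, \sum_i c i = 0 &
    forall d, \sum_i c i * k (a i) d = 0].
Proof.
move=> DN.
pose M : 'M[R]_(N, 1 + #|D|) :=
  row_mx (const_mx 1) (\matrix_(i, j) k (a i) (enum_val j)).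
have /rowV0Pn[c /sub_kermxP cM c0] : kermx M != 0.
  by rewrite kermx_eq0 /row_free neq_ltn (leq_ltn_trans (rank_leq_col M)).
have [cM1 cM2] : c *m const_mx 1 = 0 :> 'rV_1
    /\ c *m (\matrix_(i, j) k (a i) (enum_val j)) = 0 :> 'rV_#|D|.
  by apply: eq_row_mx; rewrite -mul_mx_row row_mx0.
have c1 : \sum_i c 0 i = 0.
  move/matrixP: cM1 => /(_ 0 0); rewrite !mxE => /esym E.
  apply/esym; rewrite [LHS]E.
  by apply: eq_bigr => i _; rewrite mxE mulr1.
exists (c 0); split => //; last first.
  move=> d; move/matrixP: cM2 => /(_ 0 (enum_rank d)); rewrite !mxE => /esym E.
  apply/esym; rewrite [LHS]E.
  by apply: eq_bigr => i _; rewrite mxE enum_rankK.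
(* If no coefficient were positive, the [- c 0 i] would be nonnegative with sum zero, so [c] would
   vanish. *)
apply: contrapT => /forallNP cle0; move/eqP: c0; apply.
apply/rowP => i; rewrite mxE.
have : forall i, 0 <= - c 0 i.
  by move=> j; rewrite oppr_ge0 leNgt; apply/negP; exact: cle0.
move=> nc0; apply/eqP; rewrite -oppr_eq0; apply/eqP.
apply: (psumr_eq0P (P := xpredT) (F := fun i => - c 0 i)) => //.
by rewrite sumrN c1 oppr0.
Qed.

(* Moves the weights along an affine dependence until one of them vanishes. *)
Lemma hull_reduce N z : (#|D| < N)%N -> hull k A N.+1 z -> hull k A N z.
Proof.
move=> DN [w [a [w0 w1 Aa za]]].
have [c [[i1 ci1] c0 ck]] := affine_dependence a (DN : (#|D|.+1 < N.+1)%N).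
(* The least ratio [w i / c i] over positive [c i] is the largest step [t] that keeps every
   [w i - t * c i] nonnegative, and it cancels the weight at [i0]. *)
have [i0 ci0 i0min] := @arg_minP _ _ _ i1 (fun i => 0 < c i) (fun i => w i / c i) ci1.
pose t := w i0 / c i0.
have t0 : 0 <= t by rewrite divr_ge0 // ltW.
pose w' i := w i - t * c i.
have w'0 i : 0 <= w' i.
  rewrite subr_ge0; have [ci|ci] := ltP 0 (c i).
    by rewrite -ler_pdivlMr// i0min.
  by rewrite (le_trans _ (w0 i))// mulr_ge0_le0.
have w'i0 : w' i0 = 0 by rewrite /w' divfK ?subrr// gt_eqF.
exists (fun i => w' (lift i0 i)), (fun i => a (lift i0 i)); split => //.
- transitivity (\sum_i w' i); first by rewrite (bigD1_ord i0)//= w'i0 add0r.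
  by rewrite big_split/= sumrN -mulr_sumr c0 mulr0 subr0.
- move=> d; transitivity (\sum_i w' i * k (a i) d).
    under eq_bigr do rewrite mulrBl -mulrA.
    by rewrite big_split/= sumrN -mulr_sumr ck mulr0 subr0.
  by rewrite (bigD1_ord i0)//= w'i0 mul0r add0r.
Qed.

(** Points are removed while there are more than [#|D| + 1] of them, and shorter combinations are
    padded. A fixed number of weights and points thus parametrises the whole hull. *)
Lemma caratheodory N z : hull k A N z -> hull k A #|D|.+1 z.
Proof.
elim: N => [|N IH] hz; first exact: hull_widen hz.
have [DN|ND] := ltnP #|D| N; first exact/IH/hull_reduce.
by apply: hull_widen hz.
Qed.

Lemma hull_segment N z a t : 0 <= t <= 1 -> hull k A N z -> A a ->
  hull k A N.+1 (fun d => z d + t * (k a d - z d)).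
Proof.
move=> /andP[t0 t1] [w [b [w0 w1 Ab zb]]] Aa.
exists (fun i => oapp (fun j => (1 - t) * w j) t (unlift ord0 i)),
  (fun i => oapp b a (unlift ord0 i)); split => [i||i|d].
- by case: (unlift _ _) => [j|] //=; rewrite mulr_ge0// subr_ge0.
- rewrite big_ord_recl unlift_none /=.
  under eq_bigr do rewrite liftK /=.
  by rewrite -mulr_sumr w1 mulr1 addrC subrK.
- by case: (unlift _ _).
- rewrite big_ord_recl unlift_none /=.
  under eq_bigr do rewrite liftK /= -mulrA.
  by rewrite -mulr_sumr -zb; ring.
Qed.

End Hull.

(** * Strict separation of a point from the hull of a compact family *)

Section Separation.
Context (R : realType) (T : topologicalType) (D : finType).
Context (k : T -> D -> R) (A : set T).
Context (k_continuous : forall d, continuous (k^~ d)) (A_compact : compact A).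

(** The squared distance to [z] is continuous in the weights and the points, which range over a
    compact set: the simplex, a closed slice of a cube, times a power of [A]. *)
Lemma hull_closest N (z : D -> R) : hull k A N !=set0 ->
  exists2 p, hull k A N p &
  forall q, hull k A N q ->
    \sum_d (p d - z d) ^+ 2 <= \sum_d (q d - z d) ^+ 2.
Proof.
pose X : topologicalType :=
  (prod_topology (fun _ : 'I_N => R : topologicalType) *
   prod_topology (fun _ : 'I_N => T))%type.
pose I01 : set R := `[0, 1].
pose W : set (prod_topology (fun _ : 'I_N => R : topologicalType)) :=
  [set w | forall i : 'I_N, I01 (w i)] `&` [set w | \sum_i w i = 1].
pose B : set X := W `*` [set a | forall i, A (a i)].
pose u (x : X) d := \sum_i x.1 i * k (x.2 i) d.
pose F (x : X) : R := \sum_d (u x d - z d) ^+ 2.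
have w_cont i :
    continuous (fun w : prod_topology (fun _ : 'I_N => R : topologicalType) => w i).
  exact: (@proj_continuous _ (fun _ : 'I_N => R : topologicalType) i).
have a_cont i : continuous (fun a : prod_topology (fun _ : 'I_N => T) => a i).
  exact: (@proj_continuous _ (fun _ : 'I_N => T) i).
have u_cont d : continuous (u^~ d).
  apply: continuous_sum => i; apply: continuous_mul.
    apply: (@continuous_compose X _ _ fst) (w_cont i).
    by move=> x; exact: cvg_fst.
  apply: (@continuous_compose X T _ (fun x => x.2 i) (k^~ d)) => //.
  apply: (@continuous_compose X _ _ snd) (a_cont i).
  by move=> x; exact: cvg_snd.
have F_cont : continuous F.
  have c_cont d : continuous (fun x => u x d - z d).
    exact: (continuous_subr (c := z d) (u_cont d)).
  by apply: continuous_sum => d; exact: (continuous_mul (c_cont d) (c_cont d)).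
have B_compact : compact B.
  apply: compact_setX; last exact: (tychonoff (fun=> A_compact)).
  apply: compact_closedI; first
    exact: (@tychonoff _ (fun _ : 'I_N => R : topologicalType) (fun=> I01)
      (fun=> @segment_compact R 0 1)).
  exact: (closed_level (continuous_sum w_cont)).
move=> [q0 hq0].
have hullP q : hull k A N q -> exists2 x, B x & q = u x.
  move=> [w [a [w0 w1 Aa qE]]]; exists (w, a); last exact/funext.
  split=> //; split=> // i; rewrite /I01 /= in_itv/= w0/= -w1.
  by rewrite (bigD1 i)//= lerDl sumr_ge0.
have hullB x : B x -> hull k A N (u x).
  move=> [[w01 w1] Aa]; exists x.1, x.2; split => // i.
  by have := w01 i; rewrite /I01 /= in_itv => /andP[].
have B0 : B !=set0 by have [x Bx _] := hullP _ hq0; exists x.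
have [x xB xmin] := compact_EVT_min B0 B_compact (continuous_subspaceT F_cont).
exists (u x); first by apply: hullB; rewrite -inE.
by move=> q /hullP[y yB ->]; apply: xmin; rewrite inE.
Qed.

(** The normal [c] points from the closest hull point [p] to [z], and the gap [e] is their squared
    distance. *)
Lemma hull_separation (z : D -> R) : ~ (exists N, hull k A N z) ->
  exists (c : D -> R) (e : R), 0 < e /\
    forall a, A a -> \sum_d c d * k a d <= \sum_d c d * z d - e.
Proof.
move=> zA; have [[a0 Aa0]|/forallNP A0] := pselect (A !=set0); last first.
  by exists (fun=> 0), 1; split=> // a /A0.
have h0 : hull k A 1 (k a0).
  exists (fun=> 1), (fun=> a0); split=> // [|d]; rewrite big_ord1//.
  by rewrite mul1r.
(* By Caratheodory, a minimiser over combinations of [#|D|.+1] points is a minimiser over the whole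
   hull. *)
have [|p hp pmin] := hull_closest (N := #|D|.+1) z.
  by exists (k a0); exact: caratheodory h0.
pose c d := z d - p d.
have c0 : 0 < \sum_d c d ^+ 2.
  rewrite lt_neqAle sumr_ge0 ?andbT; last by move=> *; exact: sqr_ge0.
  apply/eqP => /esym/psumr_eq0P c0; apply: zA; exists #|D|.+1.
  rewrite (_ : z = p)//; apply/funext => d; apply/eqP; rewrite -subr_eq0.
  by rewrite -sqrf_eq0 c0// => *; exact: sqr_ge0.
exists c, (\sum_d c d ^+ 2); split=> // a Aa.
pose s := \sum_d c d * (k a d - p d); pose r := \sum_d (k a d - p d) ^+ 2.
have r0 : 0 <= r by apply: sumr_ge0 => *; exact: sqr_ge0.
(* p minimises the distance to z, so moving from p towards k a does not
   decrease it. *)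
have key t : 0 <= t <= 1 -> 0 <= t * (t * r - 2 * s).
  move=> t01; have := pmin _ (caratheodory (hull_segment t01 hp Aa)).
  rewrite -subr_ge0 -sumrB; congr (0 <= _).
  rewrite mulrBr mulrA /r /s !mulr_sumr -sumrB; apply: eq_bigr => d _.
  by rewrite /c; ring.
have s0 : s <= 0.
  rewrite leNgt; apply/negP => s0.
  have rs0 : 0 < r + s by rewrite ltr_wpDl.
  (* At [t = s / (r + s)], which lies in [(0, 1]], one has [t * r <= s < 2 * s], against [key]. *)
  have t0 : 0 < s / (r + s) by rewrite divr_gt0.
  have := key (s / (r + s)); rewrite ltW//= ler_pdivrMr// mul1r lerDr r0.
  move=> /(_ isT); rewrite pmulr_rge0// subr_ge0 => h.
  suff : s / (r + s) * r < 2 * s by rewrite ltNge h.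
  rewrite mulrAC ltr_pdivrMr// -subr_gt0.
  have -> : 2 * s * (r + s) - s * r = s * r + 2 * (s * s) by ring.
  by rewrite ltr_wpDl ?mulr_ge0 ?mulr_gt0// ltW.
rewrite -subr_ge0.
suff -> : \sum_d c d * z d - \sum_d c d ^+ 2 - \sum_d c d * k a d = - s.
  by rewrite oppr_ge0.
by rewrite /s -!sumrB -sumrN; apply: eq_bigr => d _; rewrite /c; ring.
Qed.

End Separation.

(** Dependent functions are transported to [fprod], whose sums become sums over a tagged union,
    where ordinary distributivity applies. This lets sums over multi-indices factor over the tensor
    components. *)
Lemma bigA_distr_dffun (S : comPzRingType) (I : finType) (T : I -> finType)
    (F : forall i, T i -> S) :
  \sum_(a : {dffun forall i, T i}) \prod_i F i (a i) = \prod_i \sum_(t : T i) F i t.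
Proof.
pose P i : {ffun T i -> S} := [ffun t => F i t].
transitivity (\sum_(t : fprod T) \prod_(i in I) P i (t i)).
  rewrite (reindex (@dffun_of_fprod I T)); last exact/onW_bij/dffun_of_fprod_bij.
  by apply: eq_bigr => t _; apply: eq_bigr => i _; rewrite !ffunE.
rewrite big_fprod -(bigA_distr_big_dep _ (fun i u => untag 0 (P i) u)).
apply: eq_bigr => i _; rewrite big_tag.
by apply: eq_bigr => u _; congr untag; apply/funext => t; rewrite ffunE.
Qed.

(** * Pure states and the spectral decomposition of density matrices *)

Section Pure.
Variable R : realType.
Notation C := R[i].

Definition pure (I : finType) (y : cvec R I) : cmat R I :=
  fun a b => y a * conjc (y b).

(* In Defs, "^*" is Num.conj under a product and conjc elsewhere; the two are
   convertible but not syntactically equal, and conjc is used throughout here. *)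
Lemma qformE (I : finType) (A : cmat R I) (v : cvec R I) :
  qform A v = \sum_i \sum_j conjc (v i) * A i j * v j.
Proof. by []. Qed.

Lemma unit_vec_conjc k (x : cvec R 'I_k) :
  unit_vec x = (\sum_i conjc (x i) * x i = 1).
Proof. by []. Qed.

Lemma mtrace_mmul_pure (I : finType) (G : cmat R I) (y : cvec R I) :
  mtrace (mmul G (pure y)) = qform G y.
Proof.
rewrite qformE.
by apply: eq_bigr => a _; apply: eq_bigr => b _; rewrite /pure; ring.
Qed.

Lemma mtrace_mmul_sum (I J : finType) (G : cmat R I) (c : J -> C)
    (P : J -> cmat R I) :
  mtrace (mmul G (fun a b => \sum_t c t * P t a b)) =
  \sum_t c t * mtrace (mmul G (P t)).
Proof.
rewrite /mtrace /mmul.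
under [RHS]eq_bigr do rewrite mulr_sumr.
rewrite [RHS]exchange_big; apply: eq_bigr => a _ /=.
under [RHS]eq_bigr do rewrite mulr_sumr.
rewrite [RHS]exchange_big; apply: eq_bigr => b _ /=.
by rewrite mulr_sumr; apply: eq_bigr => t _; ring.
Qed.

Lemma mul_conjc_real (x : C) :
  conjc x * x = (complex.Re x ^+ 2 + complex.Im x ^+ 2)%:C.
Proof.
by case: x => x y; apply/eqP; rewrite eq_complex /=; apply/andP; split;
  apply/eqP; ring.
Qed.

Lemma unit_vecE k (x : cvec R 'I_k) : unit_vec x <->
  \sum_i (complex.Re (x i) ^+ 2 + complex.Im (x i) ^+ 2) = 1.
Proof.
rewrite unit_vec_conjc; under eq_bigr do rewrite mul_conjc_real.
by rewrite -rmorph_sum/=; split=> [/(congr1 (@complex.Re R))|->].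
Qed.

Lemma hermitian_pure (I : finType) (y : cvec R I) : Defs.hermitian (pure y).
Proof. by move=> a b; rewrite /pure rmorphM/= conjcK mulrC. Qed.

Lemma density_pure k (x : cvec R 'I_k) : unit_vec x -> density (pure x).
Proof.
move=> x1; split; first exact: hermitian_pure.
(* With [s] the inner product of [x] and [v], the form of the rank-one matrix at [v] is the squared
   modulus of [s]. *)
- move=> v; pose s : C := \sum_i conjc (x i) * v i.
  suff -> : qform (pure x) v = conjc s * s.
    by rewrite mul_conjc_real lecR addr_ge0 ?sqr_ge0.
  rewrite qformE rmorph_sum/= mulr_suml; apply: eq_bigr => i _.
  rewrite mulr_sumr; apply: eq_bigr => j _.
  by rewrite rmorphM/= conjcK /pure; ring.
- by rewrite -[RHS]x1; apply: eq_bigr => i _; rewrite /pure mulrC.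
Qed.

(** Each eigenvalue is the value of the quadratic form at its unit eigenvector, hence real and
    nonnegative. *)
Lemma density_spectral k (A : cmat R 'I_k) : density A ->
  exists (lam : 'I_k -> R) (v : 'I_k -> cvec R 'I_k),
    [/\ forall t, 0 <= lam t, forall t, unit_vec (v t) &
        forall a b, A a b = \sum_t (lam t)%:C * pure (v t) a b].
Proof.
move=> [Aherm Apsd _]; pose M := \matrix_(i, j) A i j : 'M[C]_k.
have Mherm : M \is hermsymmx.
  apply/is_hermitianmxP; rewrite expr0 scale1r.
  by apply/matrixP => i j; rewrite !mxE Aherm.
have /orthomx_spectralP ME := hermitian_normalmx Mherm.
set P := spectralmx M in ME; set sp := spectral_diag M in ME.
have PU : P \is unitarymx := spectral_unitarymx M.
rewrite invmx_unitary// in ME.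
(* In [M = P^dagger diag(sp) P] the eigenvectors are the columns of [P^dagger], that is, the
   conjugated rows of [P]. *)
pose v t : cvec R 'I_k := fun a => conjc (P t a).
have spE t : sp 0 t = qform A (v t).
  have : P *m M *m map_mx Num.conj P^T = diag_mx sp.
    rewrite ME !mulmxA (unitarymxP PU) mul1mx -mulmxA (unitarymxP PU).
    by rewrite mulmx1.
  move=> /matrixP/(_ t t); rewrite [RHS]mxE eqxx mulr1n => <-.
  rewrite mxE qformE exchange_big; apply: eq_bigr => b _.
  rewrite mxE mulr_suml; apply: eq_bigr => a _.
  by rewrite /v conjcK !mxE.
have sp0 t : 0 <= sp 0 t by rewrite spE.
have spR t : (complex.Re (sp 0 t))%:C = sp 0 t.
  by rewrite RRe_real// ger0_real.
exists (fun t => complex.Re (sp 0 t)), v; split => [t|t|a b].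
- by rewrite -lecR spR.
- have /matrixP/(_ t t) := unitarymxP PU; rewrite !mxE eqxx => PE.
  by rewrite unit_vec_conjc -[RHS]PE; apply: eq_bigr => i _; rewrite !mxE /v conjcK.
- have /matrixP/(_ a b) := ME; rewrite [LHS]mxE => ->.
  rewrite mxE; apply: eq_bigr => t _.
  by rewrite mul_mx_diag !mxE spR /pure /v conjcK; ring.
Qed.

End Pure.

(** * Product states and Hermitian observables *)

Section Tensor.
Context (R : realType) (m : nat) (dims : 'I_m -> nat).
Notation C := R[i].
Implicit Types (G rho M : cmat R (tidx dims)).

Lemma tensor_mat_pure (x : forall j, cvec R 'I_(dims j)) a b :
  tensor_mat (fun j => pure (x j)) a b = pure (tensor_vec x) a b.
Proof. by rewrite /tensor_mat big_split /= /pure /tensor_vec rmorph_prod. Qed.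

Lemma mtrace_pure_tensor (x : forall j, cvec R 'I_(dims j)) :
  (forall j, unit_vec (x j)) -> mtrace (pure (tensor_vec x)) = 1.
Proof.
move=> x1; transitivity (\prod_j \sum_(i < dims j) pure (x j) i i).
  rewrite -bigA_distr_dffun; apply: eq_bigr => a _.
  by rewrite -tensor_mat_pure.
by apply: big1 => j _; have [_ _] := density_pure (x1 j).
Qed.

Lemma separable_pure rho : separable rho ->
  exists (J : finType) (q : J -> R) (x : J -> Omega R dims),
    (forall t, 0 <= q t) /\
    rho = fun a b => \sum_t (q t)%:C * pure (tensor_vec (sval (x t))) a b.
Proof.
move=> [K [p [r [p0 _ rD ->]]]].
pose lam l j := projT1 (cid (density_spectral (rD l j))).
have lamP l j := projT2 (cid (density_spectral (rD l j))).
pose v l j := projT1 (cid (lamP l j)).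
have vP l j : [/\ forall t, 0 <= lam l j t, forall t, unit_vec (v l j t) &
    forall a b, r l j a b = \sum_t (lam l j t)%:C * pure (v l j t) a b].
  exact: projT2 (cid (lamP l j)).
have x1 (t : 'I_K * tidx dims) j : unit_vec (v t.1 j (t.2 j)).
  by have [] := vP t.1 j.
(* Expanding the tensor product of the spectral sums gives one term per multi-index, which picks an
   eigenvector in each factor; its weight is [p] times the product of the eigenvalues picked. *)
exists ('I_K * tidx dims)%type,
  (fun t : 'I_K * tidx dims => p t.1 * \prod_j lam t.1 j (t.2 j)),
  (fun t : 'I_K * tidx dims => exist _ (fun j => v t.1 j (t.2 j)) (x1 t)).
split=> [t|].
  rewrite mulr_ge0// prodr_ge0// => j _.
  by have [] := vP t.1 j.
apply/funext => a; apply/funext => b /=.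
rewrite -(pair_big xpredT xpredT (fun l (f : tidx dims) =>
  (p l * \prod_j lam l j (f j))%:C *
  pure (tensor_vec (fun j => v l j (f j))) a b))/=.
apply: eq_bigr => l _.
under [RHS]eq_bigr do rewrite rmorphM/= -mulrA -tensor_mat_pure.
rewrite -mulr_sumr; congr (_ * _).
transitivity (\prod_j \sum_t (lam l j t)%:C * pure (v l j t) (a j) (b j)).
  by apply: eq_bigr => j _; have [_ _ ->] := vP l j.
rewrite -bigA_distr_dffun; apply: eq_bigr => f _.
by rewrite big_split/= rmorph_prod.
Qed.

Definition coords (M : cmat R (tidx dims)) (d : tidx dims * tidx dims * bool) : R :=
  if d.2 then complex.Re (M d.1.1 d.1.2) else complex.Im (M d.1.1 d.1.2).

(** Turns a separating hyperplane into an observable: trace one lets the constant [s] enter as a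
    multiple of the identity, and the 2 comes from symmetrising. *)
Lemma functional_hermitian (c : tidx dims * tidx dims * bool -> R) (s : R) :
  exists2 G, Defs.hermitian G &
  forall M, Defs.hermitian M -> mtrace M = 1 ->
  mtrace (mmul G M) = (2 * (\sum_d c d * coords M d - s))%:C.
Proof.
(* Re (Tr (H M)) is the functional c, so G = H + H^dagger - 2 s. *)
pose H (a b : tidx dims) : C := c (b, a, true) -i* c (b, a, false).
pose G a b := H a b + conjc (H b a) - (2 * s * (a == b)%:R)%:C.
exists G => [a b|M Mh M1].
  rewrite /G (eq_sym b); apply/eqP; rewrite eq_complex /=.
  by apply/andP; split; apply/eqP; ring.
rewrite /mtrace /mmul.
transitivity (\sum_a \sum_b (H a b * M b a + conjc (H a b * M b a))
    - (2 * s)%:C * mtrace M).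
  rewrite /mtrace mulr_sumr -sumrB.
  transitivity (\sum_a (\sum_b H a b * M b a + \sum_b conjc (H b a) * M b a
      - (2 * s)%:C * M a a)).
    apply: eq_bigr => a _; rewrite -big_split.
    rewrite -[X in _ = _ - X](_ : \sum_b (2 * s * (a == b)%:R)%:C * M b a = _).
      by rewrite -sumrB; apply: eq_bigr => b _; rewrite /G mulrBl mulrDl.
    rewrite (bigD1 a)//= eqxx mulr1 big1 ?addr0// => b ba.
    by rewrite eq_sym (negbTE ba) mulr0 mul0r.
  rewrite !sumrB; congr (_ - _); rewrite !big_split/=.
  under [RHS]eq_bigr do rewrite big_split/=.
  rewrite big_split/=; congr (_ + _).
  (* Swapping the indices and using that [M] is Hermitian makes the adjoint part the conjugate of
     the first sum. *)
  rewrite exchange_big; apply: eq_bigr => a _; apply: eq_bigr => b _.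
  by rewrite rmorphM/= -Mh.
rewrite M1 mulr1 mulrBr rmorphB/=; congr (_ - _).
rewrite mulr_sumr rmorph_sum/=.
rewrite exchange_big pair_big/=.
transitivity (\sum_(ab : tidx dims * tidx dims) \sum_(t : bool)
    (2 * (c (ab, t) * coords M (ab, t)))%:C); last first.
  by rewrite pair_big/=; apply: eq_bigr => -[ab t].
apply: eq_bigr => -[a b] _ /=.
rewrite big_bool /coords/= /H.
case: (M a b) => x y; apply/eqP; rewrite eq_complex/=; apply/andP; split;
  apply/eqP; ring.
Qed.

End Tensor.

(** * Compactness of the pure product states *)

Section PureStateHull.
Context (R : realType) (m : nat) (dims : 'I_m -> nat).
Notation C := R[i].

Definition complex_continuous (T : topologicalType) (f : T -> C) :=
  continuous (fun x => complex.Re (f x)) /\ continuous (fun x => complex.Im (f x)).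

Lemma complex_continuous_mul (T : topologicalType) (f g : T -> C) :
  complex_continuous f -> complex_continuous g ->
  complex_continuous (fun x => f x * g x).
Proof.
move=> [fr fi] [gr gi]; split.
- rewrite (_ : (fun x => _) = (fun x => complex.Re (f x) * complex.Re (g x) -
    complex.Im (f x) * complex.Im (g x))); last first.
    by apply/funext => x; case: (f x) => ? ?; case: (g x).
  move=> x; apply: cvgB; [exact: (continuous_mul fr gr)|
    exact: (continuous_mul fi gi)].
- rewrite (_ : (fun x => _) = (fun x => complex.Re (f x) * complex.Im (g x) +
    complex.Im (f x) * complex.Re (g x))); last first.
    by apply/funext => x; case: (f x) => ? ?; case: (g x).
  move=> x; apply: cvgD; [exact: (continuous_mul fr gi)|
    exact: (continuous_mul fi gr)].
Qed.

Lemma complex_continuous_conj (T : topologicalType) (f : T -> C) :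
  complex_continuous f -> complex_continuous (fun x => conjc (f x)).
Proof.
move=> [fr fi]; split.
- rewrite (_ : (fun x => _) = (fun x => complex.Re (f x)))//.
  by apply/funext => x; case: (f x).
- rewrite (_ : (fun x => _) = (fun x => - complex.Im (f x))); last first.
    by apply/funext => x; case: (f x).
  by move=> x; apply: cvgN; exact: fi.
Qed.

Lemma complex_continuous_prod (T : topologicalType) (I : finType) (f : I -> T -> C) :
  (forall i, complex_continuous (f i)) ->
  complex_continuous (fun x => \prod_i f i x).
Proof.
move=> fc; elim: (index_enum I) => [|i s IH].
  rewrite (_ : (fun x => _) = fun=> 1); last by apply/funext => x; rewrite big_nil.
  by split=> x; exact: cvg_cst.
rewrite (_ : (fun x => _) = fun x => f i x * \prod_(j <- s) f j x).
  exact: complex_continuous_mul.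
by apply/funext => x; rewrite big_cons.
Qed.

(** A tuple of vectors is flattened into its real coordinates, so that the parameter space is a
    power of [R], to which Tychonoff's theorem applies. *)
Definition pidx : eqType := ({j : 'I_m & 'I_(dims j)} * bool)%type.
Definition param_index (j : 'I_m) (i : 'I_(dims j)) (t : bool) : pidx :=
  (existT (fun j => 'I_(dims j)) j i, t).

Definition param : topologicalType := prod_topology (fun _ : pidx => R : topologicalType).

Definition vec_of_param (p : param) (j : 'I_m) : cvec R 'I_(dims j) :=
  fun i => p (param_index i true) +i* p (param_index i false).

Arguments vec_of_param p j i : clear implicits.

Definition unit_params : set param := [set p | forall j, unit_vec (vec_of_param p j)].

Definition pure_coords (p : param) := coords (pure (tensor_vec (vec_of_param p))).

Lemma param_proj_continuous (x : pidx) : continuous (fun p : param => p x).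
Proof. exact: (@proj_continuous _ (fun _ : pidx => R : topologicalType) x). Qed.

Lemma pure_coords_continuous d : continuous (pure_coords^~ d).
Proof.
have vc a : complex_continuous (fun p => tensor_vec (vec_of_param p) a).
  by apply: complex_continuous_prod => j; split; exact: param_proj_continuous.
case: d => -[a b] t.
have [] := complex_continuous_mul (vc a) (complex_continuous_conj (vc b)).
by case: t.
Qed.

(** The norm equations define a closed set and bound each coordinate by 1 in absolute value, so the
    set lies in a compact cube. *)
Lemma unit_params_compact : compact unit_params.
Proof.
pose N j (p : param) := \sum_(i < dims j)
  (p (param_index i true) * p (param_index i true) +
   p (param_index i false) * p (param_index i false)).
have unitE : unit_params = \bigcap_j [set p | N j p = 1].
  apply/seteqP; split=> p.
    by move=> pu j _; exact: (proj1 (unit_vecE _) (pu j)).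
  by move=> pu j; apply: (proj2 (unit_vecE _)); exact: pu.
pose I11 : set R := `[-1, 1].
apply: (@subclosed_compact param _ [set p : param | forall x : pidx, I11 (p x)]).
- rewrite unitE; apply: closed_bigI => j _; apply: closed_level.
  apply: continuous_sum => i.
  by apply: continuous_add;
    apply: (continuous_mul (@param_proj_continuous _) (@param_proj_continuous _)).
- exact: (@tychonoff _ (fun _ : pidx => R : topologicalType) (fun=> I11)
    (fun=> @segment_compact R (-1) 1)).
- move=> p; rewrite unitE => pN [[j i] t]; rewrite /I11 /= in_itv/=.
  have sq_le1 (x : R) : x * x <= 1 -> -1 <= x <= 1 by move=> ?; apply/andP; split; nra.
  apply: sq_le1; rewrite -(pN j Logic.I) /N (bigD1 i)//=.
  apply: (@le_trans _ _ (p (param_index i true) * p (param_index i true) +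
      p (param_index i false) * p (param_index i false))).
    by case: t; rewrite ?lerDl ?lerDr -expr2 sqr_ge0.
  by rewrite lerDl sumr_ge0// => l _; rewrite addr_ge0// -expr2 sqr_ge0.
Qed.

Lemma hull_separable (M : cmat R (tidx dims)) N :
  hull pure_coords unit_params N (coords M) -> separable M.
Proof.
move=> [w [p [w0 w1 pu ME]]].
exists N, w, (fun l j => pure (vec_of_param (p l) j)); split=> //.
  by move=> l j; apply: density_pure; exact: pu.
apply/funext => a; apply/funext => b.
have Re_eq := ME (a, b, true); have Im_eq := ME (a, b, false).
rewrite /coords /pure_coords/= in Re_eq Im_eq.
under eq_bigr do rewrite tensor_mat_pure.
apply/eqP; rewrite eq_complex; apply/andP; split; apply/eqP.
- rewrite raddf_sum/= Re_eq; apply: eq_bigr => l _.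
  by rewrite /coords/=; case: (pure _ a b) => ? ? /=; ring.
- rewrite raddf_sum/= Im_eq; apply: eq_bigr => l _.
  by rewrite /coords/=; case: (pure _ a b) => ? ? /=; ring.
Qed.

End PureStateHull.
Arguments vec_of_param {R m dims} p j i.

(** * The two implications *)

Lemma not_coherent_of_entangled (R : realType) (m : nat) (dims : 'I_m -> nat)
  (dims_pos : forall j, (0 < dims j)%N) (rho : cmat R (tidx dims)) :
  entangled rho ->
  not_coherent (posi (scriptC rho `|` @Lge R (Omega R dims))).
Proof.
move=> [[rhoH _ rho1] rhoN].
have [|c [e [e0 ce]]] := hull_separation
  (@pure_coords_continuous R m dims) (@unit_params_compact R m dims)
  (z := coords rho).
  by move=> [N hN]; apply: rhoN; exact: hull_separable hN.
pose s := \sum_d c d * coords rho d.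
(* Taking [s] to be the value of the functional at [rho] makes [Tr (G rho)] zero. *)
have [G GH GE] := functional_hermitian c s.
pose f (x : Omega R dims) := complex.Re (qform G (tensor_vec (sval x))).
have f_le x : f x <= - e.
  pose p : param R dims := fun u : pidx dims =>
    if u.2 then complex.Re (sval x (tag u.1) (tagged u.1))
    else complex.Im (sval x (tag u.1) (tagged u.1)).
  have px : vec_of_param p = sval x.
    apply: functional_extensionality_dep => j; apply/funext => i.
    by rewrite /vec_of_param /p /=; case: (sval x j i).
  have pu : @unit_params R m dims p by move=> j; rewrite px; exact: (svalP x).
  rewrite /f -mtrace_mmul_pure GE; last 2 first.
  - exact: hermitian_pure.
  - exact: mtrace_pure_tensor (svalP x).
  have := ce _ pu; rewrite /pure_coords px -/s /coords /=.
  by lra.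
exists f; split.
  exists 1%N, (fun=> 1), (fun=> f); split=> // [_|].
    left; exists G; split=> //; rewrite GE//.
    by rewrite /s subrr mulr0.
  by apply/funext => x; rewrite big_ord1 mul1r.
apply: (@le_lt_trans _ _ (- e)); last by rewrite oppr_lt0.
(* Bounding [sup] takes a nonempty range: the first basis vector of each factor gives a point of
   [Omega]. *)
apply: ge_sup; last by move=> _ [x _ <-].
have x1 j : unit_vec (fun i : 'I_(dims j) => (i == Ordinal (dims_pos j))%:R : R[i]).
  rewrite unit_vec_conjc (bigD1 (Ordinal (dims_pos j)))// eqxx conjc1 mulr1.
  rewrite big1 => [|i /negbTE ->]; first exact: addr0.
  by rewrite mulr0.
by exists (f (exist _ _ x1)), (exist _ _ x1).
Qed.

Lemma separable_coherent (R : realType) (m : nat) (dims : 'I_m -> nat)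
  (rho : cmat R (tidx dims)) : mtrace rho = 1 -> separable rho ->
  ~ not_coherent (posi (scriptC rho `|` @Lge R (Omega R dims))).
Proof.
move=> rho1 /separable_pure[J [q [x [q0 rhoE]]]] [f [[K [lam [s [lam0 sS fE]]]] fsup]].
have f_lt y : f y < 0.
  apply: le_lt_trans (fsup); apply: ub_le_sup; last by exists y.
  (* On a set without upper bound [sup] defaults to 0, which is not negative. *)
  apply: contrapT => fN; move: (fsup); rewrite sup_out ?ltxx// => -[_]; exact: fN.
have s_ge i : 0 <= \sum_t q t * s i (x t).
  have [[G [GH Grho sE]]|[[M sM] s_inf]] := sS i.
    move: Grho; rewrite rhoE mtrace_mmul_sum lecE => /andP[_].
    rewrite raddf_sum/=; congr (_ <= _); apply: eq_bigr => t _.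
    by rewrite mtrace_mmul_pure sE; case: (qform _ _) => ? ? /=; ring.
  apply: sumr_ge0 => t _; rewrite mulr_ge0//; apply: le_trans s_inf _.
  (* [inf] is a genuine lower bound because [- M] bounds the range from below. *)
  apply: ge_inf; last by exists (x t).
  by exists (- M) => _ [y _ <-]; have := sM y; rewrite ler_norml => /andP[].
(* Pure product states have trace one, so the total weight is the trace of [rho]. *)
have q1 : \sum_t q t = 1.
  have : mtrace rho = (\sum_t q t)%:C.
    rewrite rhoE /mtrace exchange_big rmorph_sum/=; apply: eq_bigr => t _.
    rewrite -mulr_sumr -[LHS]/((q t)%:C * mtrace (pure (tensor_vec (sval (x t))))).
    by rewrite mtrace_pure_tensor ?mulr1//; exact: svalP (x t).
  by rewrite rho1 => /(congr1 (@complex.Re R))/= <-.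
have f_ge : 0 <= \sum_t q t * f (x t).
  rewrite fE; under eq_bigr do rewrite mulr_sumr.
  rewrite exchange_big sumr_ge0// => i _ /=.
  under eq_bigr do rewrite mulrCA.
  by rewrite -mulr_sumr mulr_ge0.
(* A nonnegative average of negative values forces every weight to vanish, against their sum being
   1. *)
have qf_le t : 0 <= - (q t * f (x t)).
  by rewrite oppr_ge0 mulr_ge0_le0// ltW.
have q_eq0 t : q t = 0.
  have /eqP : - (q t * f (x t)) = 0.
    apply: (psumr_eq0P (P := xpredT) (F := fun t => - (q t * f (x t)))) => //.
    by apply/eqP; rewrite eq_le sumr_ge0// sumrN oppr_le0 f_ge.
  by rewrite oppr_eq0 mulf_eq0 (lt_eqF (f_lt _)) orbF => /eqP.
by move/eqP: q1; rewrite big1 ?(eq_sym 0) ?oner_eq0.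
Qed.

Theorem theorem2 (R : realType) (m : nat) (dims : 'I_m -> nat)
  (dims_pos : forall j, (0 < dims j)%N)
  (rho : cmat R (tidx dims)) (rho_density : density rho) :
  entangled rho <->
  not_coherent (posi (scriptC rho `|` @Lge R (Omega R dims))).
Proof.
split; first exact: not_coherent_of_entangled.
have [_ _ rho1] := rho_density.
by move=> nc; split=> // /(separable_coherent rho1).
Qed.
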